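(* If a label $\mathcal M$ is not of finite type then $X(\mathcal M)$ and $X_+(\mathcal M)$ each contain non-periodic recurrent points. If a label $\mathcal M$ is of finite type then $e$ is the only recurrent point of $X(\mathcal M)$ or $X_+(\mathcal M)$, and so $(X(\mathcal M),S)$ and $(X_+(\mathcal M),S)$ are CT systems. In that case, $(X(\mathcal M),S)$ and $(X_+(\mathcal M),S)$ are LE and topologically transitive but not weak mixing.
   Context: Write $\mathbb N=\{1,2,\dots\}$. An $\mathbb N$-vector is a function $\mathbf m:\mathbb N\to\{0,1,2,\dots\}$ with finite support; $FIN(\mathbb N)$ is the additive monoid of all $\mathbb N$-vectors, with identity $\mathbf 0$ and the pointwise order. A label is a set $\mathcal M\subset FIN(\mathbb N)$ such that $\mathbf 0\le\mathbf m_1\le\mathbf m\in\mathcal M$ implies $\mathbf m_1\in\mathcal M$ (the empty set is a label); it is of finite type if it contains no infinite strictly increasing sequence. Fix an odd integer $b\ge5$ and a partition $\{D_\ell:\ell\in\mathbb N\}$ of $\mathbb N$ into infinite sets with $\min D_\ell<\min D_{\ell+1}$. Define $k:\mathbb Z\to\mathbb Z$ by $k(n)=b^{n-1}$ for $n\ge1$, $k(0)=0$, $k(-n)=-k(n)$. $IP(k)$ (resp. $IP_+(k)$) is the set of sums of finite subsets of $k(\mathbb Z)$ (resp. of $k(\{0,1,2,\dots\})$). Each $t\in IP(k)$ has a unique expansion $t=k(j_1)+\dots+k(j_r)$ with $|j_1|>\dots>|j_r|>0$ ($r=0$ for $t=0$); its length vector $\mathbf r(t)\in FIN(\mathbb N)$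 is $\mathbf r(t)_\ell=\#\{i:|j_i|\in D_\ell\}$. For a label $\mathcal M$, $A[\mathcal M]=\{t\in IP(k):\mathbf r(t)\in\mathcal M\}$, $A_+[\mathcal M]=A[\mathcal M]\cap IP_+(k)$, and $x[\mathcal M],x_+[\mathcal M]\in\{0,1\}^{\mathbb Z}$ are the characteristic functions of $A[\mathcal M]$ and $A_+[\mathcal M]$; $e=x[\emptyset]$ is the zero sequence. $S$ is the shift $S(x)_t=x_{t+1}$, and $X(\mathcal M)$, $X_+(\mathcal M)$ are the orbit closures (under $S^n$, $n\in\mathbb Z$) of $x[\mathcal M]$, $x_+[\mathcal M]$. For a homeomorphism $T$ of a compact metric space $X$: a point $x$ is recurrent if it lies in the closure of $\{T^nx:n\ne0\}$; $(X,T)$ is CT (center trivial) if there is a unique recurrent point (necessarily a fixed point); $(X,T)$ is topologically transitive if for all nonempty open $U,V$ there is $n\in\mathbb Z$ with $T^{-n}U\cap V\ne\emptyset$; it is weak mixing if $(X\times X,T\times T)$ is topologically transitive; it is LE (locally equicontinuous) if each $x\in X$ is an equicontinuity point in its orbit closure, i.e. for every $\epsilon>0$ there is $\delta>0$ such that $d(T^nx,T^nx')<\epsilon$ for all $n\in\mathbb Z$ whenever $x'\in\overline{\{T^nx:n\in\mathbb Z\}}$ and $d(x,x')<\delta$.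
   Formalization: The claim ''not weak mixing'' is proved only for nonempty labels: for the empty label (of finite type) both systems reduce to the single fixed point e, which is trivially weak mixing, so the claim fails there. *)

(* Defs.v *)
From HB Require Import structures.
From mathcomp Require Import all_boot all_order all_algebra finmap.
From mathcomp Require Import all_classical all_reals topology.

Set Implicit Arguments.
Unset Strict Implicit.
Unset Printing Implicit Defensive.
Import Order.TTheory GRing.Theory Num.Theory.
Local Open Scope classical_set_scope.
Local Open Scope ring_scope.

(* A system (X, T) is given by a homeomorphism T of an ambient space E and a
   T-invariant closed set X of E; the topology of X is the one induced by E. *)

Record homeo (E : topologicalType) := Homeo {
  homeo_fun :> E -> E;
  homeo_inv : E -> E;
  homeo_funK : cancel homeo_fun homeo_inv;
  homeo_invK : cancel homeo_inv homeo_fun;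
  homeo_cts : continuous homeo_fun;
  homeo_inv_cts : continuous homeo_inv }.

Definition iterz (E : topologicalType) (T : homeo E) (n : int) : E -> E :=
  match n with
  | Posz m => iter m T
  | Negz m => iter m.+1 (homeo_inv T)
  end.

Section Systems.
Context {E : topologicalType}.
Implicit Types (T : homeo E) (X : set E) (x : E).

Definition orbit T x : set E := range (fun n : int => iterz T n x).

Definition orbit_closure T x : set E := closure (orbit T x).

Definition recurrent T x : Prop :=
  closure [set iterz T n x | n in [set n : int | n != 0]] x.

Definition periodic T x : Prop := exists2 n : int, n != 0 & iterz T n x = x.

Definition center_trivial T X : Prop := exists! x, X x /\ recurrent T x.

(* The relatively open sets of X are the sets U `&` X with U open in E. *)
Definition topologically_transitive T X : Prop :=
  forall U V : set E, open U -> open V ->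
    U `&` X !=set0 -> V `&` X !=set0 ->
    exists n : int, (iterz T n @^-1` (U `&` X)) `&` (V `&` X) !=set0.

Definition compatible_metric (R : realType) (d : E -> E -> R) : Prop :=
  [/\ forall x y, d x y = 0 <-> x = y,
      forall x y, d x y = d y x,
      forall x y z, d x z <= d x y + d y z &
      forall x (U : set E),
        nbhs x U <-> exists2 r : R, 0 < r & [set y | d x y < r] `<=` U].

Definition locally_equicontinuous (R : realType) (d : E -> E -> R) T X : Prop :=
  forall x, X x -> forall eps : R, 0 < eps ->
    exists2 delta : R, 0 < delta &
      forall x', orbit_closure T x x' -> d x x' < delta ->
        forall n : int, d (iterz T n x) (iterz T n x') < eps.

End Systems.

Section ProductSystem.
Context {E : topologicalType} (T : homeo E).

Definition sq_fun (f : E -> E) (p : E * E) : E * E := (f p.1, f p.2).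

Lemma sq_funK : cancel (sq_fun T) (sq_fun (homeo_inv T)).
Proof. by case=> x y; rewrite /sq_fun /= !homeo_funK. Qed.

Lemma sq_invK : cancel (sq_fun (homeo_inv T)) (sq_fun T).
Proof. by case=> x y; rewrite /sq_fun /= !homeo_invK. Qed.

Lemma sq_cts (f : E -> E) : continuous f -> continuous (sq_fun f).
Proof.
move=> cf p; apply: cvg_pair.
  by apply: (@continuous_comp _ _ _ fst f); [exact: cvg_fst | exact: cf].
by apply: (@continuous_comp _ _ _ snd f); [exact: cvg_snd | exact: cf].
Qed.

Definition homeo_sq : homeo (E * E)%type :=
  Homeo sq_funK sq_invK (sq_cts (@homeo_cts _ T)) (sq_cts (@homeo_inv_cts _ T)).

Definition weak_mixing (X : set E) : Prop :=
  topologically_transitive homeo_sq (X `*` X).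

End ProductSystem.

(* {0,1}^Z with the product topology. *)
Definition seqZ : topologicalType := prod_topology (fun _ : int => bool).

Definition shift_fun (s : int) (x : seqZ) : seqZ := fun t => x (t + s).

Lemma shift_cts (s : int) : continuous (shift_fun s).
Proof.
move=> x; apply/cvg_sup => t.
apply/cvg_image; first by rewrite eqEsubset; split=> // c _; exists (fun _ => c).
move=> A Ax; exists [set y : seqZ | A (y t)].
  exact: (@proj_continuous int (fun _ => bool) (t + s) x A Ax).
rewrite eqEsubset; split=> [c [y Ay <-]//|c Ac].
by exists (fun _ => c).
Qed.

Lemma shift_funK (s s' : int) : s + s' = 0 ->
  cancel (shift_fun s) (shift_fun s').
Proof.
by move=> ss' x; apply/funext => t; rewrite /shift_fun -addrA [s' + s]addrC ss' addr0.
Qed.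

Definition shiftZ : homeo seqZ :=
  Homeo (shift_funK (subrr 1)) (shift_funK (addNr 1)) (@shift_cts 1)
    (@shift_cts (-1)).

(* The index set {1,2,...} of the coordinates of vectors and of the blocks D_l
   is shifted to nat: D l and m l stand for D_(l+1) and m_(l+1). The elements
   of the blocks are not shifted: the sets D l partition {1,2,...}. *)

Definition FIN : set (nat -> nat) :=
  [set m | finite_set [set l | m l <> 0%N]].

Definition vec_le (m1 m2 : nat -> nat) : Prop := forall l, (m1 l <= m2 l)%N.

Definition vec_lt (m1 m2 : nat -> nat) : Prop := vec_le m1 m2 /\ m1 <> m2.

Definition is_label (M : set (nat -> nat)) : Prop :=
  M `<=` FIN /\
  forall m1 m, FIN m1 -> vec_le m1 m -> M m -> M m1.

Definition finite_type (M : set (nat -> nat)) : Prop :=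
  ~ exists m : nat -> nat -> nat,
      (forall i, M (m i)) /\ (forall i, vec_lt (m i) (m i.+1)).

Definition is_min (A : set nat) (n : nat) : Prop :=
  A n /\ forall n', A n' -> (n <= n')%N.

Definition admissible_partition (D : nat -> set nat) : Prop :=
  [/\ classical_sets.partition [set: nat] D [set n | (0 < n)%N],
      forall l, infinite_set (D l) &
      forall l n n', is_min (D l) n -> is_min (D l.+1) n' -> (n < n')%N].

Section LabeledSubshifts.
Variables (b : nat) (D : nat -> set nat).

(* Negz m is - m.+1, and k_ (- m.+1) = - b ^ m. *)
Definition k_ (n : int) : int :=
  match n with
  | Posz 0 => 0
  | Posz m.+1 => b%:Z ^+ m
  | Negz m => - b%:Z ^+ m
  end.

Definition subset_sums (A : set int) : set int :=
  [set t | exists F : {fset int},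
     (forall z, z \in F -> A z) /\ t = \sum_(z <- F) z].

Definition IP : set int := subset_sums (range k_).

Definition IPp : set int := subset_sums (k_ @` [set n | 0 <= n]).

Definition is_expansion (t : int) (s : seq int) : Prop :=
  [/\ sorted (fun i j : int => (`|j| < `|i|)%N) s,
      all (fun j : int => (0 < `|j|)%N) s &
      t = \sum_(j <- s) k_ j].

(* Total in t; the default [::] is only used when t is not in IP. *)
Definition expansion (t : int) : seq int := xget [::] (is_expansion t).

Definition length_vector (t : int) : nat -> nat :=
  fun l => count (fun j : int => `[< D l `|j|%N >]) (expansion t).

Definition labeled_set (M : set (nat -> nat)) : set int :=
  [set t | IP t /\ M (length_vector t)].

Definition labeled_setp (M : set (nat -> nat)) : set int :=
  labeled_set M `&` IPp.

Definition char_seq (A : set int) : seqZ := fun t => `[< A t >].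

Definition x_ (M : set (nat -> nat)) : seqZ := char_seq (labeled_set M).

Definition xp_ (M : set (nat -> nat)) : seqZ := char_seq (labeled_setp M).

Definition X_ (M : set (nat -> nat)) : set seqZ := orbit_closure shiftZ (x_ M).

Definition Xp_ (M : set (nat -> nat)) : set seqZ := orbit_closure shiftZ (xp_ M).

End LabeledSubshifts.

Definition zero_seq : seqZ := fun _ => false.

Lemma x_set0 b D : x_ b D set0 = zero_seq.
Proof. by apply/funext => t; apply/asboolP => -[]. Qed.

Lemma iterz_shiftZ (n : int) (x : seqZ) : iterz shiftZ n x = fun t => x (t + n).
Proof.
have it s m : iter m (shift_fun s) x = fun t => x (t + s *+ m).
  elim: m => [|m IH]; first by apply/funext => t; rewrite mulr0n addr0.
  by rewrite iterS IH; apply/funext => t; rewrite /shift_fun mulrS addrA.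
case: n => m; rewrite /iterz [LHS]it; apply/funext => t.
  by rewrite natz.
by rewrite NegzE -[in RHS]natz mulNrn.
Qed.

(* Main.v *)
Require Import Defs.
From mathcomp Require Import all_boot all_order all_algebra finmap.
From mathcomp Require Import all_classical all_reals topology.
From mathcomp Require Import zify.
Set Implicit Arguments.
Unset Strict Implicit.
Unset Printing Implicit Defensive.
Import Order.TTheory GRing.Theory Num.Theory.
Local Open Scope classical_set_scope.
Local Open Scope ring_scope.

(** Why the theorem holds.

Call [t] balanced if it has an expansion in base [b] with digits -1, 0, 1
([balanced]; the flag [p] restricts the digits to 0, 1, so that both
subshifts are treated at once: [p = false] gives X(M), [p = true] gives X_+(M)).
Since [b >= 5], an expansion is determined by its value ([balanced_inj]),
twice a nonzero balanced number is never balanced ([double_balanced]), and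
adding to a fixed [t] a balanced number [v] that is supported on high positions
creates no carries: [t + v] is balanced exactly when [t] is, and then its
length vector is the sum of those of [t] and [v] ([balanced_split]).

Hence, if an ultrafilter [G] on the integers contains, for every [K], the
balanced numbers supported above [K], then the shifts of x[N] along [G]
converge to x[N'], where N' is the label of the vectors [m] such that [m + r(v)]
is in [N] for [G]-almost all [v] ([limit_label], [labeled_seq_limit]).
The inclusion of N' in [N] drives everything that follows.

Finite type. Let [G] contain A[M]. Along [G] the low positions of [t] stabilise
([adic_limit]): they form a growing family of vectors of [M], which cannot grow
forever. So the limit of the shifts of x[M] along [G] is a translate of some
x[N] with N inside [M] ([shift_limit]). Every point of the orbit closure that
is not zero is therefore a translate of such an x[N] with 0 in [N]. If x[N]
were recurrent, the same analysis applied to x[N] would write x[N] as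
a translate of x[N'] by some [u] with N' inside [N]. Then [u] and [2u] are both
balanced, so [u = 0] and [N' = N], and any [m] in [N] has a strictly larger
[m + r(v)] in [N]: a maximal [m] gives a contradiction
([labeled_seq_nonrecurrent]). So zero is the only recurrent point; it does lie
in the orbit closure because of the gaps between balanced numbers
([zero_in_orbit_closure]).

Local equicontinuity is then automatic, since a non-recurrent point is isolated
in its own orbit closure ([nonrecurrent_isolated]), where equicontinuity is
trivial. For the same reason x[M], when it is not zero, is isolated in X(M),
and no iterate of S x S can bring (x, S x) to (x, x), which refutes weak mixing
([nonrecurrent_not_mixing]). Transitivity holds for every orbit closure.

Infinite type. Let [w_0, w_1, ...] be the successive differences of an infinite
strictly increasing sequence of [M], realised by balanced numbers [v_i]
supported above [i]. Consider the labels [N] that contain all finite sums of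
distinct [w_i] and for which x[N] is in X(M). By Zorn's lemma there is a minimal
one, and its limit label along the [v_i] belongs to the same family, so by
minimality it equals [N]. Thus the shifts of x[N] along the [v_i] return to
x[N], and x[N] is recurrent ([infinite_type_recurrent]); it is not
periodic, because a period [n] would make both [n] and [2n] balanced. *)

(** * Sequences of signed positions *)

Section BalancedSequences.
Implicit Types (p : bool) (i j : int) (s : seq int).

Definition absgt i j := (`|j| < `|i|)%N.

Definition position p j := (0 < `|j|)%N && (p ==> (0 <= j)).

(** The sequences of positions of IP, or of IP_+ when [p] holds: a position
    [j] stands for the term k(j), so its sign is the digit. *)
Definition balanced p s := sorted absgt s && all (position p) s.

Definition low_part K s := [seq j <- s | (`|j| <= K)%N].
Definition high_part K s := [seq j <- s | (K < `|j|)%N].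

Lemma absgt_trans : transitive absgt.
Proof. by move=> y x z; rewrite /absgt; lia. Qed.

Lemma balanced_cons p j s : balanced p (j :: s) = [&& position p j, all (absgt j) s & balanced p s].
Proof.
rewrite /balanced /= path_sortedE; last exact: absgt_trans.
by case: (all (absgt j) s); rewrite /= ?andbF // andbCA.
Qed.

Lemma balanced_weak p s : balanced p s -> balanced false s.
Proof.
case/andP=> s1 s2; apply/andP; split=> //; apply: sub_all s2 => j.
by rewrite /position => /andP[-> _].
Qed.

Lemma balanced_filter p (a : pred int) s : balanced p s -> balanced p [seq j <- s | a j].
Proof.
case/andP=> s1 s2; apply/andP; split.
  exact: (sorted_filter absgt_trans).
by apply/allP => j; rewrite mem_filter => /andP[_]; apply/allP.
Qed.

Lemma cat_high_low p K s : balanced p s -> high_part K s ++ low_part K s = s.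
Proof.
elim: s => [//|j s IH]; rewrite balanced_cons => /and3P[_ js hs].
rewrite /high_part /low_part /=; case: (leqP `|j|%N K) => jK /=; last by rewrite [RHS](_ : _ = j :: (high_part K s ++ low_part K s)) ?IH.
have hK : all (fun i => `|i| <= K)%N s.
  by apply: sub_all js => i; rewrite /absgt; lia.
rewrite [X in X ++ _](_ : _ = [::]) ?cat0s /=.
  by congr (_ :: _); apply/all_filterP.
rewrite -[RHS](filter_pred0 s); apply: eq_in_filter => i /(allP hK) /=; lia.
Qed.

Lemma balanced_cat p K v s : balanced p v -> balanced p s -> all (fun j => K < `|j|)%N v ->
  all (fun j => `|j| <= K)%N s -> balanced p (v ++ s).
Proof.
elim: v => [//|j v IH]; rewrite balanced_cons /= => /and3P[dj jv hv] hs /andP[jK vK] sK.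
rewrite balanced_cons dj IH //= all_cat jv /= andbT.
by apply: sub_all sK => i; rewrite /absgt; lia.
Qed.

Lemma low_part_low_part K K' s : (K <= K')%N -> low_part K (low_part K' s) = low_part K s.
Proof.
by move=> KK; rewrite /low_part -filter_predI; apply: eq_filter => j /=; lia.
Qed.

(** Passing from level [K] to level [K.+1] adds at most one term, so it is
    decided by two membership tests; an ultrafilter can therefore fix the low
    parts level by level. *)
Lemma low_part_succ p K s : balanced p s -> low_part K.+1 s =
  (if Posz K.+1 \in s then [:: Posz K.+1] else if Negz K \in s then [:: Negz K] else [::])
    ++ low_part K s.
Proof.
elim: s => [//|j s IH]; rewrite balanced_cons => /and3P[_ js hs].
rewrite /low_part /= !inE.
have js' i : i \in s -> (`|i| < `|j|)%N by move=> /(allP js).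
have absP : `|Posz K.+1|%N = K.+1 by [].
have absN : `|Negz K|%N = K.+1 by [].
case: (eqVneq (`|j|)%N K.+1) => jK.
  have n1 : (Posz K.+1 \in s) = false by apply/negP => /js'; rewrite jK ltnn.
  have n2 : (Negz K \in s) = false by apply/negP => /js'; rewrite jK absN ltnn.
  have es : [seq x <- s | (`|x| <= K.+1)%N] = [seq x <- s | (`|x| <= K)%N].
    by apply: eq_in_filter => i /js'; rewrite jK ltnS => h; rewrite h leqW.
  rewrite jK leqnn ltnn n1 n2 !orbF es.
  case: j jK {js js'} => m; first by rewrite absz_nat => ->; rewrite eqxx.
  by case=> ->; rewrite eqxx.
have jP : (Posz K.+1 == j) = false.
  by apply/negbTE; apply: contra_neq jK => <-.
have jN : (Negz K == j) = false.
  by apply/negbTE; apply: contra_neq jK => <-.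
rewrite jP jN !orFb.
case: (leqP (`|j|)%N K) => jK'.
  have n1 : (Posz K.+1 \in s) = false by apply/negP => /js'; rewrite absP ltnNge leqW.
  have n2 : (Negz K \in s) = false by apply/negP => /js'; rewrite absN ltnNge leqW.
  rewrite n1 n2 leqW //=; congr (_ :: _); apply: eq_in_filter => i /js' h.
  by rewrite !(leq_trans (ltnW h)) ?leqW.
have -> : (`|j| <= K.+1)%N = false by apply/negbTE; rewrite -ltnNge ltn_neqAle eq_sym jK.
exact: IH.
Qed.

Lemma seq_bounded s : exists K, all (fun j => `|j| <= K)%N s.
Proof.
elim: s => [|j s [K h]]; first by exists 0.
exists (maxn `|j|%N K) => /=; rewrite leq_maxl; apply: sub_all h => i; lia.
Qed.

End BalancedSequences.

(** * Size and uniqueness of balanced expansions *)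

Section Values.
Variable b : nat.
Hypothesis b_ge5 : (5 <= b)%N.
Implicit Types (p : bool) (i j t : int) (s : seq int).

Definition kval s : int := \sum_(j <- s) k_ b j.

Lemma kval_nil : kval [::] = 0.
Proof. exact: big_nil. Qed.

Lemma kval_cons j s : kval (j :: s) = k_ b j + kval s.
Proof. exact: big_cons. Qed.

Lemma kval_cat s1 s2 : kval (s1 ++ s2) = kval s1 + kval s2.
Proof. exact: big_cat. Qed.

Lemma k_opp j : k_ b (- j) = - k_ b j.
Proof. by case: j => [[|n]|n] //=; rewrite opprK. Qed.

Lemma k_nonneg j : (0 < `|j|)%N -> 0 <= j -> k_ b j = (b ^ (`|j|).-1)%N%:Z.
Proof. by case: j => [[|n]|n] //= _ _; rewrite -(natz (b ^ n)) natrX natz. Qed.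

Lemma k_abs j : (0 < `|j|)%N ->
  (0 <= j /\ k_ b j = (b ^ (`|j|).-1)%N%:Z) \/ (j <= 0 /\ k_ b j = - (b ^ (`|j|).-1)%N%:Z).
Proof.
move=> j0; case: (lerP 0 j) => hj; first by left; rewrite k_nonneg.
right; split; first exact: ltW.
have := @k_nonneg (- j); rewrite abszN k_opp => /(_ j0) e; rewrite -e ?opprK //; lia.
Qed.

Lemma pow_gap n m : (n < m)%N -> (b ^ n * 5 <= b ^ m)%N.
Proof.
move=> nm; apply: (@leq_trans (b ^ n * b)); first by rewrite leq_pmul2l // expn_gt0; lia.
by rewrite -expnSr leq_exp2l; lia.
Qed.

(** The terms after the leading one are dominated by a geometric series of
    ratio at most 1/5, whose sum stays below a quarter of the leading term. *)
Lemma kval_small j s : all (position false) s -> path absgt j s ->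
  4 * `|kval s| < (b ^ (`|j|).-1)%N%:Z.
Proof.
have b0 : (0 < b)%N by lia.
elim: s j => [|i s IH] j /=; first by rewrite kval_nil => _ _; have := expn_gt0 b (`|j|).-1; lia.
move=> /andP[/andP[i0 _] ds] /andP[ji pis].
rewrite kval_cons; have := IH i ds pis; rewrite /absgt in ji.
have : (b ^ (`|i|).-1 * 5 <= b ^ (`|j|).-1)%N by apply: pow_gap; lia.
have [[_ ->]|[_ ->]] := k_abs i0; lia.
Qed.

Lemma kval_lead p j s : balanced p (j :: s) ->
  (0 < `|j|)%N /\ 4 * `|kval (j :: s) - k_ b j| < (b ^ (`|j|).-1)%N%:Z.
Proof.
rewrite /balanced => /andP[/= pjs /andP[/andP[j0 _] ds]]; split=> //.
rewrite kval_cons addrAC subrr add0r; apply: kval_small => //.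
by apply: sub_all ds => i; rewrite /position => /andP[-> _].
Qed.

(** The size of the value determines the absolute value of the leading
    position and its sign determines the sign; induction does the rest. *)
Lemma balanced_inj s s' : balanced false s -> balanced false s' -> kval s = kval s' -> s = s'.
Proof.
have cmp i j s1 s2 : balanced false (i :: s1) -> balanced false (j :: s2) ->
    kval (i :: s1) = kval (j :: s2) -> (`|i| < `|j|)%N -> False.
  move=> /kval_lead[i0 h1] /kval_lead[j0 h2] e ij; move: h1; rewrite e.
  have : (b ^ (`|i|).-1 * 5 <= b ^ (`|j|).-1)%N by apply: pow_gap; lia.
  have := expn_gt0 b (`|i|).-1.
  by move: h2; have [[_ ->]|[_ ->]] := k_abs i0; have [[_ ->]|[_ ->]] := k_abs j0; lia.
have nz j s1 : balanced false (j :: s1) -> kval (j :: s1) <> 0.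
  move=> /kval_lead[j0 h1] e; move: h1; rewrite e.
  have := expn_gt0 b (`|j|).-1.
  by have [[_ ->]|[_ ->]] := k_abs j0; lia.
elim: s s' => [|i s IH] [|j s'] //.
- by move=> _ /nz h /esym e; case: h; rewrite e kval_nil.
- by move=> /nz h _ e; case: h; rewrite e kval_nil.
move=> hs hs' e; have eij : i = j.
  case: (ltngtP `|i|%N `|j|%N) => [h|h|h]; [by case: (cmp _ _ _ _ hs hs' e h)|by case: (cmp _ _ _ _ hs' hs (esym e) h)|].
  have [i0 h1] := kval_lead hs; have [j0 h2] := kval_lead hs'.
  move: h1 h2; rewrite e; have := expn_gt0 b (`|j|).-1.
  have [[i1 ->]|[i1 ->]] := k_abs i0; have [[j1 ->]|[j1 ->]] := k_abs j0; rewrite h; lia.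
subst j; congr (_ :: _); apply: IH.
- by move: hs; rewrite balanced_cons => /and3P[].
- by move: hs'; rewrite balanced_cons => /and3P[].
by move: e; rewrite !kval_cons => /addrI.
Qed.

Lemma kval_eq0 p s : balanced p s -> kval s = 0 -> s = [::].
Proof. by move=> hs e; apply: balanced_inj => //; [exact: balanced_weak hs|rewrite kval_nil]. Qed.

(** The absolute value is within a quarter of a power of [b] of its leading
    term [b ^ n]: either [n <= L], or the leading term is at least [5 * b ^ L]. *)
Lemma kval_gap p s L : balanced p s ->
  4 * `|kval s| < 5 * (b ^ L)%N%:Z \/ 15 * (b ^ L)%N%:Z < 4 * `|kval s|.
Proof.
have b0 : (0 < b)%N by lia.
have bL := expn_gt0 b L; rewrite b0 /= in bL.
case: s => [|j s] hs; first by left; rewrite kval_nil; lia.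
have [j0 h] := kval_lead hs.
have := expn_gt0 b (`|j|).-1; rewrite b0 /= => bj.
case: (leqP (`|j|).-1 L) => jL; [left|right].
  have : (b ^ (`|j|).-1 <= b ^ L)%N by rewrite leq_exp2l; lia.
  move: h; have [[_ ->]|[_ ->]] := k_abs j0; lia.
have : (b ^ L * 5 <= b ^ (`|j|).-1)%N by apply: pow_gap.
move: h; have [[_ ->]|[_ ->]] := k_abs j0; lia.
Qed.

(** The double of a balanced number with leading term [b ^ n] has size
    between [3/2] and [5/2] times [b ^ n], inside a gap. *)
Lemma double_balanced p q s s' : balanced p s -> balanced q s' -> kval s' = kval s + kval s -> kval s = 0.
Proof.
case: s => [|j s]; first by rewrite kval_nil.
move=> hs hs' e; exfalso.
have [j0 h] := kval_lead hs; have := kval_gap (`|j|).-1 hs'.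
have := expn_gt0 b (`|j|).-1; have -> : (0 < b)%N by lia.
rewrite e; move: h; have [[_ ->]|[_ ->]] := k_abs j0; lia.
Qed.

Lemma kval_low_high p K s : balanced p s -> kval s = kval (low_part K s) + kval (high_part K s).
Proof. by move=> hs; rewrite -{1}(cat_high_low K hs) kval_cat addrC. Qed.

Lemma low_part_small p K s : balanced p s -> 4 * `|kval (low_part K s)| < (b ^ K)%N%:Z.
Proof.
move=> hs; have hl : balanced p (low_part K s) by apply: balanced_filter.
have -> : K = (`|Posz K.+1|).-1%N by [].
apply: kval_small.
  by have := balanced_weak hl => /andP[].
rewrite path_sortedE; last exact: absgt_trans.
have /andP[-> _] := hl; rewrite andbT.
apply/allP => j; rewrite mem_filter => /andP[/= ? _]; rewrite /absgt /=; lia.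
Qed.

Lemma kval_high_dvd p K s : balanced p s -> all (fun j => K < `|j|)%N s -> exists c : int, kval s = c * (b ^ K)%N%:Z.
Proof.
elim: s => [|j s IH]; first by exists 0; rewrite kval_nil mul0r.
rewrite balanced_cons /= => /and3P[/andP[j0 _] _ hs] /andP[jK sK].
have [c e] := IH hs sK; rewrite kval_cons e.
have E : (b ^ (`|j|).-1)%N%:Z = (b ^ ((`|j|).-1 - K))%N%:Z * (b ^ K)%N%:Z.
  by rewrite -PoszM -expnD subnK //; lia.
have [[_ ->]|[_ ->]] := k_abs j0; rewrite E.
  by exists ((b ^ ((`|j|).-1 - K))%N%:Z + c); rewrite mulrDl.
by exists (- (b ^ ((`|j|).-1 - K))%N%:Z + c); rewrite mulrDl mulNr.
Qed.

(** No carries: the low part of [w] and [c] are congruent modulo [b ^ K], and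
    both are too small to differ. *)
Lemma balanced_split p K c v w : balanced p v -> balanced p w -> all (fun j => K < `|j|)%N v ->
  2 * `|c| < (b ^ K)%N%:Z -> c + kval v = kval w ->
  c = kval (low_part K w) /\ high_part K w = v.
Proof.
move=> hv hw vK cK e.
have hhw : balanced p (high_part K w) by apply: balanced_filter.
have hK : all (fun j => K < `|j|)%N (high_part K w) by apply: filter_all.
have [c1 e1] := kval_high_dvd hv vK; have [c2 e2] := kval_high_dvd hhw hK.
have ls := low_part_small K hw.
move: e; rewrite (kval_low_high K hw) => e.
have c12 : c1 = c2.
  apply/eqP; rewrite -subr_eq0; apply/negPn/negP => n0.
  have : (b ^ K)%N%:Z <= `|(c1 - c2) * (b ^ K)%N%:Z|.
    by rewrite normrM [X in _ * X]ger0_norm // ler_peMl //; lia.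
  have -> : (c1 - c2) * (b ^ K)%N%:Z = kval (low_part K w) - c by rewrite mulrBl -e1 -e2; lia.
  lia.
have ev : kval v = kval (high_part K w) by rewrite e1 e2 c12.
split; first by move: e; rewrite ev => /addIr.
by apply: balanced_inj; rewrite ?ev //; [exact: balanced_weak hhw|exact: balanced_weak hv].
Qed.

End Values.

(** * Subset sums and labeled sets *)

Section SubsetSums.
Variable b : nat.
Hypothesis b_ge5 : (5 <= b)%N.
Implicit Types (p : bool) (i j t : int) (s : seq int).

Lemma is_expansionE t s : is_expansion b t s <-> balanced false s /\ kval b s = t.
Proof.
rewrite /balanced (@eq_all _ (position false) (fun j => 0 < `|j|)%N); last first.
  by move=> j; rewrite /position andbT.
by split=> [[-> -> ->]//|[/andP[h1 h2] <-]].
Qed.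

Lemma expansion_kval s : balanced false s -> expansion b (kval b s) = s.
Proof.
move=> hs; have /is_expansionE h : balanced false s /\ kval b s = kval b s by [].
have /is_expansionE[h1 h2] := xgetPex [::] (ex_intro _ s h).
exact: (balanced_inj b_ge5 h1 hs).
Qed.

Lemma k_inj : injective (k_ b).
Proof.
move=> i j.
case: (eqVneq `|i|%N 0%N) => [/eqP|i0].
  rewrite absz_eq0 => /eqP ->; case: (eqVneq `|j|%N 0%N) => [/eqP|j0].
    by rewrite absz_eq0 => /eqP ->.
  rewrite -lt0n in j0; have := expn_gt0 b (`|j|).-1.
  by have [[_ ->]|[_ ->]] := k_abs b_ge5 j0 => /=; lia.
case: (eqVneq `|j|%N 0%N) => [/eqP|j0].
  rewrite absz_eq0 => /eqP ->; rewrite -lt0n in i0; have := expn_gt0 b (`|i|).-1.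
  by have [[_ ->]|[_ ->]] := k_abs b_ge5 i0 => /=; lia.
have sg l : `|l|%N != 0%N -> balanced false [:: l] by move=> h; rewrite /balanced /= /position lt0n h.
move=> e; suff [] : [:: i] = [:: j] by [].
by apply: (balanced_inj b_ge5); rewrite ?sg // !kval_cons e.
Qed.

(** A subset of the values of [k_] may contain opposite pairs k(j), k(-j).
    Such pairs cancel, and what is left is a balanced expansion. *)
Lemma sum_balanced B (F : {fset int}) :
  (forall z, z \in F -> exists2 j, (`|j| <= B)%N & z = k_ b j) ->
  exists s, [/\ balanced false s, all (fun j => `|j| <= B)%N s,
    forall j, j \in s -> k_ b j \in F & kval b s = \sum_(z <- F) z].
Proof.
elim: B F => [|B IH] F hF.
  exists [::]; split=> //; rewrite kval_nil big_seq big1 // => z /hF [j].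
  by rewrite leqn0 absz_eq0 => /eqP -> ->.
set a := k_ b (Posz B.+1); have ea : k_ b (Negz B) = - a by rewrite -k_opp.
have a0 : a != - a.
  rewrite -addr_eq0; have := expn_gt0 b B.
  by rewrite /a k_nonneg //=; lia.
pose F' := ((F `\ a) `\ (- a))%fset.
have [z|s [hs sB sF es]] := IH F'.
  rewrite !in_fsetD1 => /and3P[z1 z2 /hF [j jB ez]]; exists j => //.
  rewrite leq_eqVlt in jB; case/orP: jB => [/eqP jB|//].
  case: j jB ez => n; first by rewrite absz_nat => -> ez; rewrite ez eqxx in z2.
  by case=> -> ez; rewrite ez ea eqxx in z1.
have sB' : all (fun j => `|j| <= B.+1)%N s by apply: sub_all sB => j; lia.
have sF' j : j \in s -> k_ b j \in F by move=> /sF; rewrite !in_fsetD1 => /and3P[].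
have cons_ok j : `|j|%N = B.+1 -> balanced false (j :: s).
  move=> jB; rewrite balanced_cons hs andbT /position jB /=.
  by apply: sub_all sB => i; rewrite /absgt jB; lia.
have eF : \sum_(z <- F) z = (if a \in F then a else 0) + (if - a \in F then - a else 0) + kval b s.
  have h2 : \sum_(z <- (F `\ a)%fset) z = (if - a \in F then - a else 0) + kval b s.
    have -> : (- a \in F) = (- a \in (F `\ a)%fset) by rewrite in_fsetD1 eq_sym a0.
    case: ifP => h; first by rewrite (big_fsetD1 _ h) es.
    by rewrite add0r es /F'; apply: eq_fbigl => z; rewrite [RHS]in_fsetD1; case: eqP => // ->.
  rewrite -addrA -h2; case: ifP => h; first by rewrite (big_fsetD1 _ h).
  by rewrite add0r; apply: eq_fbigl => z; rewrite [RHS]in_fsetD1; case: eqP => // ->.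
rewrite eF; case: ifPn => h1; case: ifPn => h2.
- by exists s; split=> //; rewrite addrN add0r.
- exists (Posz B.+1 :: s); split=> //; first exact: cons_ok.
  + by rewrite /= leqnn.
  + by move=> j; rewrite inE => /orP[/eqP ->|/sF'].
  + by rewrite kval_cons addr0.
- exists (Negz B :: s); split=> //; first exact: cons_ok.
  + by rewrite /= leqnn.
  + by move=> j; rewrite inE => /orP[/eqP ->|/sF' //]; rewrite ea.
  + by rewrite kval_cons add0r ea.
- by exists s; split=> //; rewrite !add0r.
Qed.

Lemma balanced_sum p (A : set int) s : balanced p s -> (forall j, j \in s -> A (k_ b j)) ->
  subset_sums A (kval b s).
Proof.
move=> hs hA; suff [F [FE eF]] : exists F : {fset int},
    (forall z, (z \in F) = (z \in map (k_ b) s)) /\ kval b s = \sum_(z <- F) z.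
  by exists F; split=> // z; rewrite FE => /mapP[j js ->]; apply: hA.
elim: s hs {hA} => [_|j s IH].
  by exists fset0; split=> [z|]; rewrite ?in_fset0 // kval_nil big_seq_fset0.
rewrite balanced_cons => /and3P[_ js /IH[F [FE eF]]].
exists (k_ b j |` F)%fset; split=> [z|]; first by rewrite in_fset1U FE /= inE.
rewrite kval_cons big_fsetU1 ?eF // FE mem_map; last exact: k_inj.
by apply/negP => /(allP js); rewrite /absgt ltnn.
Qed.

Lemma subset_sum_balanced (A : set int) t : A `<=` range (k_ b) -> subset_sums A t ->
  exists s, [/\ balanced false s, forall j, j \in s -> A (k_ b j) & kval b s = t].
Proof.
move=> Ak [F [FA ->]].
have [B hB] : exists B, forall z, z \in F -> exists2 j, (`|j| <= B)%N & z = k_ b j.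
  suff {F FA} h (r : seq int) : (forall z, z \in r -> range (k_ b) z) ->
      exists B, forall z, z \in r -> exists2 j, (`|j| <= B)%N & z = k_ b j.
    by apply: h => z /FA /Ak.
  elim: r => [|z r IH] h; first by exists 0%N.
  have [|B hB] := IH; first by move=> y yr; apply: h; rewrite inE yr orbT.
  have [j _ ez] := h z (mem_head _ _).
  exists (maxn `|j|%N B) => y; rewrite inE => /orP[/eqP ->|/hB[i iB ->]].
    by exists j; rewrite ?leq_maxl.
  by exists i => //; rewrite leq_max iB orbT.
by have [s [hs _ sF es]] := sum_balanced hB; exists s; split=> // j /sF /FA.
Qed.

Lemma IP_balanced t : IP b t <-> exists2 s, balanced false s & kval b s = t.
Proof.
split=> [/subset_sum_balanced|[s hs <-]]; first by case=> // s [hs _ es]; exists s.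
by apply: (balanced_sum hs) => j _; exists j.
Qed.

Lemma IPp_balanced t : IPp b t <-> exists2 s, balanced true s & kval b s = t.
Proof.
split.
  case/subset_sum_balanced => [_ [j _ <-]|s [hs sA es]]; first by exists j.
  exists s => //; case/andP: hs => s1 s2; apply/andP; split=> //.
  apply/allP => j js; have := allP s2 j js; rewrite /position => /andP[-> _] /=.
  by have [i i0 /k_inj <-] := sA j js.
move=> [s hs <-]; apply: (balanced_sum hs) => j js; exists j => //.
by case/andP: hs => _ /allP /(_ j js) /andP[].
Qed.

Variable D : nat -> set nat.
Implicit Types M N : set (nat -> nat).

Definition length_vec s : nat -> nat := fun l => count (fun j : int => `[< D l `|j|%N >]) s.

Definition labeled p M := if p then labeled_setp b D M else labeled_set b D M.

(** This is where the two subshifts are put under a common description, in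
    terms of expansions only. *)
Lemma labeledP p M t :
  labeled p M t <-> exists s, [/\ balanced p s, kval b s = t & M (length_vec s)].
Proof.
rewrite /labeled; split.
  case: p => [[[_ Mt] /IPp_balanced[s hs es]]|[/IP_balanced[s hs es] Mt]]; exists s; split=> //;
  by move: Mt; rewrite /length_vector -es expansion_kval //; exact: balanced_weak hs.
move=> [s [hs <- Ms]].
have hw := balanced_weak hs.
have h : labeled_set b D M (kval b s).
  split; first by apply/IP_balanced; exists s.
  by rewrite /length_vector expansion_kval.
by case: p hs => // hs; split=> //; apply/IPp_balanced; exists s.
Qed.

End SubsetSums.

(** * Recurrence and isolated points in the full shift *)

Section Cylinders.
Implicit Types (x y : seqZ) (L : seq int) (n t : int).

(** The cylinders [agree L x] form a neighbourhood basis of [x]; all closures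
    below are handled through them. *)
Definition agree L x y := forall t, t \in L -> x t = y t.

Lemma nbhs_agree x L : nbhs x (agree L x).
Proof.
elim: L => [|t L IH]; first by apply: filterS filterT.
have h : nbhs x [set y : seqZ | x t = y t].
  have xt : nbhs (x t) [set c | x t = c] by apply/principal_filterP.
  exact: (@proj_continuous int (fun _ => bool) t x _ xt).
by apply: filterS2 IH h => y hL ht s; rewrite inE => /orP[/eqP ->|/hL].
Qed.

Lemma nbhs_seqZ x (U : set seqZ) : nbhs x U -> exists L, agree L x `<=` U.
Proof.
pose F : set_system seqZ := filter_from setT (fun L => agree L x).
have FF : Filter F.
  apply: filter_from_filter; first by exists [::].
  move=> L1 L2 _ _; exists (L1 ++ L2) => // y h.
  by split=> t ht; apply: h; rewrite mem_cat ht ?orbT.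
suff : F --> x by move=> h /h [L _ ?]; exists L.
apply/cvg_sup => t; apply/cvg_image.
  by rewrite eqEsubset; split=> // c _; exists (fun _ => c).
move=> A Ax; exists [set y : seqZ | A (y t)].
  by exists [:: t] => // y /(_ t (mem_head _ _)) e /=; rewrite -e; exact: nbhs_singleton Ax.
rewrite eqEsubset; split=> [c [y Ay <-]//|c Ac].
by exists (fun _ => c).
Qed.

Lemma closure_seqZ (A : set seqZ) x :
  closure A x <-> forall L, exists2 y, A y & agree L x y.
Proof.
split=> [h L|h U /nbhs_seqZ[L LU]]; first by have [y [Ay xy]] := h _ (nbhs_agree x L); exists y.
by have [y Ay /LU Uy] := h L; exists y.
Qed.

Lemma orbit_closureP x y :
  orbit_closure shiftZ x y <-> forall L, exists n, forall t, t \in L -> x (t + n) = y t.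
Proof.
split=> [/closure_seqZ h L|h].
  have [z [n _ <-] yz] := h L; exists n => t tL.
  by rewrite yz // iterz_shiftZ.
apply/closure_seqZ => L; have [n hn] := h L; exists (iterz shiftZ n x); first by exists n.
by move=> t tL; rewrite iterz_shiftZ hn.
Qed.

Lemma recurrentP x :
  recurrent shiftZ x <->
  forall L, exists2 n, n != 0 & forall t, t \in L -> x (t + n) = x t.
Proof.
split=> [/closure_seqZ h L|h].
  have [z [n n0 <-] yz] := h L; exists n => // t tL.
  by rewrite [RHS]yz // iterz_shiftZ.
apply/closure_seqZ => L; have [n n0 hn] := h L; exists (iterz shiftZ n x); first by exists n.
by move=> t tL; rewrite iterz_shiftZ hn.
Qed.

Lemma orbit_closure_self x : orbit_closure shiftZ x x.
Proof. by apply/orbit_closureP => L; exists 0 => t _; rewrite addr0. Qed.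

Lemma orbit_closure_shift x y n : orbit_closure shiftZ x y ->
  orbit_closure shiftZ x (fun t => y (t + n)).
Proof.
move=> /orbit_closureP h; apply/orbit_closureP => L.
have [m hm] := h [seq t + n | t <- L]; exists (n + m) => t tL.
by rewrite addrA hm //; apply: map_f.
Qed.

Lemma recurrent_shift x n : recurrent shiftZ x -> recurrent shiftZ (fun t => x (t + n)).
Proof.
move=> /recurrentP h; apply/recurrentP => L.
have [m m0 hm] := h [seq t + n | t <- L]; exists m => // t tL.
by rewrite addrAC hm //; apply: map_f.
Qed.

Lemma recurrent_zero : recurrent shiftZ zero_seq.
Proof. by apply/recurrentP => L; exists 1. Qed.

Lemma orbit_closure_zero y : orbit_closure shiftZ zero_seq y -> y = zero_seq.
Proof.
move=> /orbit_closureP h; apply/funext => t; have [n hn] := h [:: t].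
by rewrite -(hn t (mem_head _ _)).
Qed.

(** Only the trivial translate of [x] returns to a suitable cylinder, and the
    orbit is dense in the orbit closure, so that cylinder contains no other
    point of it. *)
Lemma nonrecurrent_isolated x : ~ recurrent shiftZ x ->
  exists L, (forall n, (forall t, t \in L -> x (t + n) = x t) -> n = 0) /\
    forall y, orbit_closure shiftZ x y -> agree L x y -> y = x.
Proof.
move=> nr; have [L hL] : exists L, forall n, (forall t, t \in L -> x (t + n) = x t) -> n = 0.
  apply: contrapT => /forallNP h; apply/nr/recurrentP => L.
  have /existsNP[n /not_implyP[hn /eqP n0]] := h L.
  by exists n.
exists L; split=> // y /orbit_closureP h xy; apply/funext => s.
have [n hn] := h (s :: L).
have n0 : n = 0.
  by apply: hL => t tL; rewrite hn ?inE ?tL ?orbT // xy.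
by rewrite -hn ?mem_head // n0 addr0.
Qed.

Lemma transitive_orbit_closure x :
  topologically_transitive shiftZ (orbit_closure shiftZ x).
Proof.
have dense (U : set seqZ) : open U -> U `&` orbit_closure shiftZ x !=set0 ->
    exists i, U (iterz shiftZ i x).
  move=> oU [y [Uy Xy]].
  by have [_ [[i _ <-] Ui]] := Xy U (open_nbhs_nbhs (conj oU Uy)); exists i.
have inX i : orbit_closure shiftZ x (iterz shiftZ i x).
  by rewrite iterz_shiftZ; apply: orbit_closure_shift; apply: orbit_closure_self.
move=> U V oU oV /(dense _ oU)[i Ui] /(dense _ oV)[j Vj].
exists (i - j), (iterz shiftZ j x); split; last by split.
suff e : iterz shiftZ (i - j) (iterz shiftZ j x) = iterz shiftZ i x by rewrite /= e; split.
by rewrite !iterz_shiftZ; apply/funext => t; rewrite -addrA subrK.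
Qed.

Lemma iterz_sq (E : topologicalType) (T : homeo E) n (u : E * E) :
  iterz (homeo_sq T) n u = (iterz T n u.1, iterz T n u.2).
Proof.
have it (f : E -> E) m : iter m (sq_fun f) u = (iter m f u.1, iter m f u.2).
  elim: m => [|m IH]; first by case: u.
  by rewrite iterS IH.
by case: n => m; rewrite /iterz [LHS]it.
Qed.

(** With [W] isolating [x], the open set [W x W] meets the square of the orbit
    closure in [(x, x)] and [W x S W] meets it in [(x, S x)]; the two points
    lie in different orbits of [S x S]. *)
Lemma nonrecurrent_not_mixing x : ~ recurrent shiftZ x ->
  ~ weak_mixing shiftZ (orbit_closure shiftZ x).
Proof.
move=> /nonrecurrent_isolated[L [hL iso]] wm.
pose X := orbit_closure shiftZ x.
have Xx : X x by apply: orbit_closure_self.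
pose W := interior (agree L x : set seqZ).
have oW : open W by apply: open_interior.
have Wx : W x by apply: nbhs_agree.
have Wiso y : X y -> W y -> y = x by move=> Xy Wy; apply: iso => //; apply: interior_subset Wy.
pose Sx := shift_fun 1 x.
have XSx : X Sx by apply: (@orbit_closure_shift _ _ 1).
pose U : set (seqZ * seqZ) := fst @^-1` W `&` snd @^-1` W.
pose V : set (seqZ * seqZ) := fst @^-1` W `&` (shift_fun (-1) \o snd) @^-1` W.
have oU : open U.
  by apply: openI; apply: open_comp => // z _; [exact: cvg_fst|exact: cvg_snd].
have oV : open V.
  apply: openI; apply: open_comp => // z _; first exact: cvg_fst.
  by apply: continuous_comp; [exact: cvg_snd|exact: shift_cts].
have [||n [[u v]]] := wm U V oU oV.
- by exists (x, x).
- by exists (x, Sx); split=> //; split=> //=; rewrite (shift_funK (subrr 1)).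
rewrite /= iterz_sq /= => -[[[/= Wu Wv] [/= Xu Xv]] [[/= Wu' Wv'] [/= Xu' Xv']]].
have eu := Wiso _ Xu' Wu'.
have ev := Wiso _ (@orbit_closure_shift _ _ (-1) Xv') Wv'.
have := Wiso _ Xu Wu; have := Wiso _ Xv Wv.
rewrite !iterz_shiftZ eu => e1 e2.
have n0 : n = 0 by apply: hL => t _; exact: (congr1 (@^~ t) e2).
have : 1 = 0 :> int.
  apply: hL => t _.
  have -> : x t = v t by rewrite -e1 n0 addr0.
  by rewrite -ev /shift_fun addrK.
by [].
Qed.

(** At a non-recurrent point a small ball of the orbit closure is reduced to
    its centre; at the fixed point the whole orbit closure is. *)
Lemma compatible_equicontinuous (R : realType) (d : seqZ -> seqZ -> R) (X : set seqZ) :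
  compatible_metric d -> (forall x, X x -> recurrent shiftZ x -> x = zero_seq) ->
  locally_equicontinuous d shiftZ X.
Proof.
move=> [d0 _ _ dn] hX x Xx eps eps0.
have dxx z : d z z = 0 by apply/d0.
have [rx|nr] := pselect (recurrent shiftZ x).
  exists 1 => // x'; rewrite (hX _ Xx rx) => /orbit_closure_zero -> _ n.
  by rewrite dxx.
have [L [_ iso]] := nonrecurrent_isolated nr.
have [r r0 rL] := (dn x _).1 (nbhs_agree x L).
exists r => // x' Xx' dx n.
by rewrite (iso _ Xx' (rL _ dx)) dxx.
Qed.

End Cylinders.

(** * Ultrafilters on the integers *)

Section Ultrafilters.

(** Compactness in the form used throughout: conditions that can be met
    finitely many at a time can be met along an ultrafilter. *)
Lemma ultra_of_finite (P : set int) (q : int -> set int) :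
  (forall L : seq int, exists2 n, P n & forall t, t \in L -> q t n) ->
  exists G : set_system int, [/\ UltraFilter G, G P & forall t, G (q t)].
Proof.
move=> h; pose Q (L : seq int) : set int := [set n | P n /\ forall t, t \in L -> q t n].
have PF : ProperFilter (filter_from setT Q).
  apply: filter_from_proper; last by move=> L _; have [n Pn qn] := h L; exists n.
  apply: filter_from_filter; first by exists [::].
  move=> L1 L2 _ _; exists (L1 ++ L2) => // n [Pn hn].
  by split; split=> // t ht; apply: hn; rewrite mem_cat ht ?orbT.
have [G [GU FG]] := ultraFilterLemma PF; exists G; split=> //.
  by apply: FG; exists [::] => // n [].
by move=> t; apply: FG; exists [:: t] => // n [_ /(_ t (mem_head _ _))].
Qed.

Lemma filter_all_seq (T : Type) (G : set_system T) (q : int -> set T) (L : seq int) :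
  Filter G -> (forall t, t \in L -> G (q t)) -> G [set n | forall t, t \in L -> q t n].
Proof.
move=> GF; elim: L => [|s L IH] h; first by apply: filterS filterT.
have h1 := IH (fun t tL => h t (mem_behead (s := s :: L) tL)).
apply: filterS2 h1 (h s (mem_head _ _)) => n hL hs t.
by rewrite inE => /orP[/eqP ->|/hL].
Qed.

Lemma ultra_shift (G : set_system int) (u : int) : UltraFilter G ->
  UltraFilter [set A | G [set n | A (n - u)]].
Proof.
move=> GU.
have -> : [set A | G [set n | A (n - u)]] = [set (fun n => n - u) @` A | A in G].
  rewrite eqEsubset; split=> A.
    move=> GA; exists [set n | A (n - u)] => //.
    rewrite eqEsubset; split=> [_ [n An <-]//|n An]; exists (n + u) => //=; rewrite addrK //.
  move=> [B GB <-] /=; apply: filterS GB => n Bn /=; exists n => //.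
apply: ultra_image; rewrite eqEsubset; split=> // n _; exists (n + u); rewrite ?addrK //.
Qed.

End Ultrafilters.

(** * Labels and limits of labeled points *)

Section Labels.
Implicit Types (M N : set (nat -> nat)) (m : nat -> nat).

Definition vec0 : nat -> nat := fun=> 0%N.
Definition vec_add m1 m2 : nat -> nat := fun l => (m1 l + m2 l)%N.

Lemma FIN_le m1 m : vec_le m1 m -> FIN m -> FIN m1.
Proof.
move=> le fm; apply: sub_finite_set fm => l /=; have := le l; lia.
Qed.

Lemma label_le M m1 m : is_label M -> vec_le m1 m -> M m -> M m1.
Proof. by move=> [MF Mh] le Mm; exact: (Mh m1 m (FIN_le le (MF _ Mm)) le Mm). Qed.

Lemma label_vec0 M m : is_label M -> M m -> M vec0.
Proof. by move=> hM; apply: label_le. Qed.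

Lemma finite_type_sub M N : N `<=` M -> finite_type M -> finite_type N.
Proof. by move=> NM fM [m [Nm mm]]; apply: fM; exists m; split=> // i; apply: NM. Qed.

(** Otherwise iterating a choice of strictly larger vectors would produce an
    infinite strictly increasing sequence. *)
Lemma finite_type_maximal M m0 : finite_type M -> M m0 ->
  exists2 m, M m & forall m', M m' -> ~ vec_lt m m'.
Proof.
move=> fM Mm0; apply: contrapT => h.
have {}h m : exists m', M m -> M m' /\ vec_lt m m'.
  apply: contrapT => /forallNP h'; apply: h; exists m.
    by have /not_implyP[] := h' m0.
  by move=> m' Mm' lt; have /not_implyP[_] := h' m'; case.
have [f hf] := choice h.
have Mi i : M (iter i f m0) by elim: i => [//|i /hf[]].
by apply: fM; exists (fun i => iter i f m0); split=> // i; have [] := hf _ (Mi i).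
Qed.

Lemma finite_type_stable M (f : nat -> nat -> nat) : finite_type M ->
  (forall i, M (f i)) -> (forall i j, (i <= j)%N -> vec_le (f i) (f j)) ->
  exists i, forall j, (i <= j)%N -> f j = f i.
Proof.
move=> fM Mf mono; have MR : finite_type (range f).
  by apply: finite_type_sub fM => _ [i _ <-].
have [|_ [i _ <-] max] := finite_type_maximal MR (m0 := f 0%N); first by exists 0%N.
exists i => j ij; apply: contrapT => ne; apply: (max (f j)); first by exists j.
by split; [exact: mono|exact: nesym].
Qed.

End Labels.

Lemma balanced_true p s : balanced true s -> balanced p s.
Proof. by case: p => //; apply: balanced_weak. Qed.

Section LengthVectors.
Variable D : nat -> set nat.
Implicit Types (p : bool) (m : nat -> nat) (s : seq int).
Local Notation length_vec := (length_vec D).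

Lemma length_vec_cat s1 s2 : length_vec (s1 ++ s2) = vec_add (length_vec s1) (length_vec s2).
Proof. by apply/funext => l; apply: count_cat. Qed.

Lemma length_vec_filter (a : pred int) s : vec_le (length_vec [seq j <- s | a j]) (length_vec s).
Proof. by move=> l; rewrite /length_vec count_filter; apply: sub_count => j /= /andP[]. Qed.

Lemma length_vec_eq0 p s : (forall n, (0 < n)%N -> exists l, D l n) ->
  balanced p s -> length_vec s = vec0 -> s = [::].
Proof.
move=> D_cover; case: s => [//|j s]; rewrite balanced_cons => /and3P[/andP[j0 _] _ _] e.
have [l Dl] := D_cover _ j0; have := congr1 (@^~ l) e.
by rewrite /length_vec /vec0 /= asboolT.
Qed.

Hypothesis D_triv : trivIset [set: nat] D.
Hypothesis D_inf : forall l, infinite_set (D l).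

(** Each unit is realised by one more leading position in the required block,
    which is infinite and so has elements beyond those already used. *)
Lemma realize_list (ls : seq nat) K : exists s,
  [/\ balanced true s, all (fun j => K < `|j|)%N s & length_vec s = fun l => count_mem l ls].
Proof.
elim: ls => [|l ls [s [hs sK es]]]; first by exists [::].
have [B sB] := seq_bounded s.
have [n Dn nB] : exists2 n, D l n & (maxn K B < n)%N.
  apply: contrapT => h; apply: (D_inf (l := l)).
  apply: sub_finite_set (finite_II (maxn K B).+1) => n Dn /=.
  by rewrite leqNgt; apply/negP => h'; apply: h; exists n.
exists (Posz n :: s); split.
- rewrite balanced_cons hs andbT; apply/andP; split; first by rewrite /position /=; lia.
  by apply: sub_all sB => i; rewrite /absgt /=; lia.
- by rewrite /= sK andbT; lia.
apply/funext => l'; rewrite /length_vec /= -/(length_vec s l') es; congr (_ + _)%N; congr nat_of_bool.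
apply/asboolP/eqP => [Dn'|<- //].
by apply: (D_triv I I); exists n.
Qed.

Lemma realize_vec m K : FIN m ->
  exists s, [/\ balanced true s, all (fun j => K < `|j|)%N s & length_vec s = m].
Proof.
move=> Fm.
have [B hB] : exists B, forall l, (B <= l)%N -> m l = 0%N.
  have [ls els] := (finite_seqP _).1 Fm; exists (\max_(l <- ls) l).+1 => l.
  apply: contraTeq => /eqP ml; rewrite -ltnNge ltnS.
  have lls : l \in ls by have : [set l | m l <> 0%N] l by []; rewrite els.
  exact: leq_bigmax_seq.
have [s [hs sK es]] := realize_list (flatten [seq nseq (m l) l | l <- index_iota 0 B]) K.
exists s; split=> //; rewrite es; apply/funext => l.
rewrite count_flatten -map_comp sumnE big_map.
under eq_bigr do rewrite /= count_nseq /=.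
case: (ltnP l B) => lB.
  rewrite (bigD1_seq l) ?mem_index_iota ?iota_uniq //= eqxx mul1n big1 ?addn0 // => i /negbTE.
  by move=> ->; rewrite mul0n.
rewrite hB // big_nat big1 // => i iB; case: eqP => [e|]; last by rewrite mul0n.
by move: iB; rewrite e; lia.
Qed.

End LengthVectors.

Section LabeledPoints.
Variable b : nat.
Hypothesis b_ge5 : (5 <= b)%N.
Variable D : nat -> set nat.
Implicit Types (p : bool) (M N : set (nat -> nat)) (m : nat -> nat) (s : seq int) (t v : int).

Local Notation kval := (kval b).
Local Notation r := (length_vector b D).
Local Notation length_vec := (length_vec D).
Local Notation labeled := (labeled b D).

Definition labeled_seq p M : seqZ := char_seq (labeled p M).

(** Belonging to an ultrafilter for all [K], these sets say that [v] tends
    to 0 in the [b]-adic sense through balanced numbers. *)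
Definition high_set p K : set int :=
  [set v | exists s, [/\ balanced p s, all (fun j => K < `|j|)%N s & kval s = v]].

(** The limit along [G] of the labels [N - r(v)]. *)
Definition limit_label (G : set_system int) N : set (nat -> nat) :=
  [set m | G [set v | N (vec_add m (r v))]].

Lemma length_vector_kval p s : balanced p s -> r (kval s) = length_vec s.
Proof. by move=> hs; rewrite /length_vector expansion_kval //; exact: balanced_weak hs. Qed.

Lemma labeled_kval p M s : balanced p s -> labeled p M (kval s) <-> M (length_vec s).
Proof.
move=> hs; split=> [/(labeledP b_ge5)[s' [hs' es' Ms']]|Ms]; last first.
  by apply/(labeledP b_ge5); exists s.
suff -> : s = s' by [].
by apply: (balanced_inj b_ge5 (balanced_weak hs) (balanced_weak hs')).
Qed.

Lemma labeled_sub p M N : N `<=` M -> labeled p N `<=` labeled p M.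
Proof.
move=> NM t /(labeledP b_ge5)[s [hs es Ns]]; apply/(labeledP b_ge5).
by exists s; split=> //; apply: NM.
Qed.

Lemma labeled_seqP p M t : reflect (labeled p M t) (labeled_seq p M t).
Proof. exact: asboolP. Qed.

Lemma labeled_seq_vec0 p M : M vec0 -> labeled_seq p M 0.
Proof.
by move=> M0; apply/labeled_seqP/(labeledP b_ge5); exists [::]; split=> //; rewrite kval_nil.
Qed.

Lemma limit_label_sub (G : set_system int) N :
  ProperFilter G -> is_label N -> limit_label G N `<=` N.
Proof.
move=> GG hN m /filter_ex[v Nv]; apply: label_le Nv => // l; exact: leq_addr.
Qed.

Lemma limit_is_label (G : set_system int) N :
  ProperFilter G -> is_label N -> is_label (limit_label G N).
Proof.
move=> GG hN; split=> [m /(limit_label_sub GG hN)|m1 m _ le]; first by case: hN => NF _ /NF.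
apply: filterS => v; apply: label_le => // l; rewrite leq_add2r; exact: le.
Qed.

(** Adding [v] from [high_set p K] to [t] creates no carries once [K] is large.
    If [t] is balanced then length vectors add up; if not, then [t + v] is
    not balanced either. *)
Lemma labeled_seq_limit p (G : set_system int) N t : UltraFilter G ->
  (forall K, G (high_set p K)) -> is_label N ->
  G [set v | labeled_seq p N (t + v) = labeled_seq p (limit_label G N) t].
Proof.
move=> GU Gh hN.
have [[s [hs <-]]|ns] := pselect (exists s, balanced p s /\ kval s = t).
  have [K sK] := seq_bounded s.
  have key v : high_set p K v -> labeled p N (kval s + v) <-> N (vec_add (length_vec s) (r v)).
    move=> [s' [hs' s'K <-]]; have hc := balanced_cat hs' hs s'K sK.
    rewrite addrC -kval_cat labeled_kval // length_vec_cat (length_vector_kval hs').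
    suff -> : vec_add (length_vec s') (length_vec s) = vec_add (length_vec s) (length_vec s') by [].
    by apply/funext => l; rewrite /vec_add addnC.
  have [GN|GN] := in_ultra_setVsetC [set v | N (vec_add (length_vec s) (r v))] GU.
    have -> : labeled_seq p (limit_label G N) (kval s) by apply/labeled_seqP/labeled_kval.
    by apply: filterS2 GN (Gh K) => v Nv /key kv; apply/labeled_seqP/kv.
  have -> : labeled_seq p (limit_label G N) (kval s) = false.
    apply/negbTE/labeled_seqP; rewrite labeled_kval // => GN'.
    by have [v []] := filter_ex (filterI GN GN').
  by apply: filterS2 GN (Gh K) => v Nv /key kv; apply/negbTE/labeled_seqP; rewrite kv.
have -> : labeled_seq p (limit_label G N) t = false.
  by apply/negbTE/labeled_seqP => /(labeledP b_ge5)[s [hs es _]]; apply: ns; exists s.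
(* Any level with [2 |t| < b ^ K] separates [t] from the high part. *)
pose K := (2 * `|t|)%N.
have tK : 2 * `|t| < (b ^ K)%N%:Z by have : (K < b ^ K)%N by apply: ltn_expl; lia.
apply: filterS (Gh K) => v [s [hs sK <-]].
apply/negbTE/labeled_seqP => /(labeledP b_ge5)[w [hw ew _]].
have [et _] := balanced_split b_ge5 hs hw sK tK (esym ew).
by apply: ns; exists (low_part K w); split=> //; apply: balanced_filter.
Qed.

Hypothesis D_cover : forall n, (0 < n)%N -> exists l, D l n.

(** The low parts of [t] converge along [G] at each level [K], to [U K] say.
    As the length vectors of the [U K] increase with [K] and stay in [M],
    they are eventually constant; since every position has a block, a constant
    length vector means that no further position is added. *)
Lemma adic_limit p M (G : set_system int) :
  is_label M -> finite_type M -> UltraFilter G -> G (labeled p M) ->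
  exists u, balanced p u /\ forall K, G [set t | exists s,
    [/\ balanced p (s ++ u), all (fun j => K < `|j|)%N s, kval (s ++ u) = t & M (length_vec (s ++ u))]].
Proof.
move=> hM fM GU GM; pose e := expansion b.
have eP t : labeled p M t -> [/\ balanced p (e t), kval (e t) = t & M (length_vec (e t))].
  by move=> /(labeledP b_ge5)[s [hs <- Ms]]; rewrite /e expansion_kval //; exact: balanced_weak hs.
have /choice[U GU_] : forall K, exists u, G [set t | low_part K (e t) = u].
  elim=> [|K [u IH]].
    exists [::]; apply: filterS GM => t /eP[/andP[_ /allP h] _ _].
    rewrite /low_part -(filter_pred0 (e t)); apply: eq_in_filter => j /h /andP[j0 _]; by rewrite leqNgt j0.
  have Gstep a1 a2 : G [set t | (Posz K.+1 \in e t) = a1] -> G [set t | (Negz K \in e t) = a2] ->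
      exists u, G [set t | low_part K.+1 (e t) = u].
    move=> G1 G2; exists ((if a1 then [:: Posz K.+1] else if a2 then [:: Negz K] else [::]) ++ u).
    apply: filterS3 (filterI IH GM) G1 G2 => t /= [<- /eP[ht _ _]] <- <-.
    exact: low_part_succ ht.
  have Gbool (j : int) : exists a, G [set t | (j \in e t) = a].
    have [h|h] := in_ultra_setVsetC [set t | j \in e t] GU; [by exists true|exists false].
    by apply: filterS h => t /negP/negbTE.
  have [a1 G1] := Gbool (Posz K.+1); have [a2 G2] := Gbool (Negz K).
  exact: Gstep G1 G2.
have UP K K' : (K <= K')%N -> exists t, [/\ labeled p M t, low_part K (e t) = U K & low_part K' (e t) = U K'].
  move=> _; have [t [At [h1 h2]]] := filter_ex (filterI GM (filterI (GU_ K) (GU_ K'))).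
  by exists t.
have balU K : balanced p (U K).
  have [t [/eP[ht _ _] <- _]] := UP K K (leqnn K); exact: balanced_filter.
have loU K K' : (K <= K')%N -> low_part K (U K') = U K.
  by move=> KK; have [t [_ <- <-]] := UP K K' KK; rewrite low_part_low_part.
have [||K0 stab] := finite_type_stable fM (f := fun K => length_vec (U K)).
- move=> K; have [t [/eP[_ _ Mt] <- _]] := UP K K (leqnn K).
  by apply: label_le Mt => //; apply: length_vec_filter.
- by move=> K K' KK; rewrite -(loU K K' KK); apply: length_vec_filter.
(* The positions of [U K] above [K0] have length vector zero, so there are none. *)
have Ustab K : (K0 <= K)%N -> U K = U K0.
  move=> KK; rewrite -(loU _ _ KK) -{1}(cat_high_low K0 (balU K)).
  rewrite (length_vec_eq0 (D := D) (p := p) (s := high_part K0 (U K))) //; first exact: balanced_filter.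
  have := stab K KK; rewrite -{1}(cat_high_low K0 (balU K)) length_vec_cat (loU _ _ KK) => h.
  by apply/funext => l; have := congr1 (@^~ l) h; rewrite /vec_add /vec0; lia.
exists (U K0); split=> // K; pose K1 := maxn K K0.
apply: filterS2 GM (GU_ K1) => t /eP[ht et Mt] /=.
rewrite Ustab ?leq_maxr // => <-; exists (high_part K1 (e t)).
rewrite (cat_high_low K1 ht); split=> //.
by apply/allP => j; rewrite mem_filter => /andP[]; rewrite /K1; lia.
Qed.

(** Writing [t = u + v] with [u] the [b]-adic limit, the shift by [t] is a
    shift by [v], which has a limit label, followed by a translation by [u]. *)
Lemma shift_limit p M (G : set_system int) :
  is_label M -> finite_type M -> UltraFilter G -> G (labeled p M) ->
  exists u N, [/\ balanced p u, is_label N, N `<=` M, N vec0 &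
    (forall m, N m -> G [set t | M (vec_add m (r (t - kval u)))]) /\
    forall t, G [set n | labeled_seq p M (t + n) = labeled_seq p N (t + kval u)]].
Proof.
move=> hM fM GU GM; have [u [hu hG]] := adic_limit hM fM GU GM.
pose G' : set_system int := [set A | G [set n | A (n - kval u)]].
have GU' : UltraFilter G' by apply: ultra_shift.
have decomp n K : (exists s, [/\ balanced p (s ++ u), all (fun j => K < `|j|)%N s,
    kval (s ++ u) = n & M (length_vec (s ++ u))]) ->
    exists s, [/\ balanced p s, all (fun j => K < `|j|)%N s, n - kval u = kval s & M (length_vec s)].
  move=> [s [hs sK <- Ms]]; exists s; split=> //.
  - move: hs; rewrite /balanced all_cat => /andP[/cat_sorted2[-> _] /andP[->]] //.
  - by rewrite kval_cat addrK.
  - by apply: label_le Ms => // l; rewrite length_vec_cat; apply: leq_addr.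
have Gh K : G' (high_set p K).
  by apply: (@filterS _ G _ _ [set n | high_set p K (n - kval u)] _ (hG K)) => n /decomp[s [hs sK en _]]; exists s; split=> //; exact: esym en.
exists u, (limit_label G' M); split=> //.
- exact: limit_is_label.
- exact: limit_label_sub.
- apply: (@filterS _ G _ _ [set n | M (vec_add vec0 (r (n - kval u)))] _ (hG 0%N)) => n /decomp[s [hs sK en Ms]] /=.
  by rewrite en (length_vector_kval hs).
split=> // t; have := @labeled_seq_limit p G' M (t + kval u) GU' Gh hM.
apply: (@filterS _ G _ [set n | labeled_seq p M (t + kval u + (n - kval u)) = _]) => n /=.
by rewrite -addrA [kval u + _]addrC subrK.
Qed.

Hypothesis D_triv : trivIset [set: nat] D.
Hypothesis D_inf : forall l, infinite_set (D l).

Lemma labeled_seq_sub_label p M N : is_label M -> labeled_seq p M = labeled_seq p N -> M `<=` N.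
Proof.
move=> hM e m Mm; have [s [hs _ es]] := realize_vec D_triv D_inf 0 (hM.1 _ Mm).
have {}hs := balanced_true p hs.
have : labeled_seq p M (kval s) by apply/labeled_seqP/labeled_kval => //; rewrite es.
by rewrite e => /labeled_seqP/labeled_kval; rewrite es; apply.
Qed.

End LabeledPoints.

(** * Recurrent points *)

(** [subsum w n m] says that [m] is the sum of the [w i] over some set of
    indices [i < n]; this form lets a later [w n] be added directly. *)
Inductive subsum (w : nat -> nat -> nat) : nat -> (nat -> nat) -> Prop :=
| Subsum0 : subsum w 0%N vec0
| Subsum_skip n m : subsum w n m -> subsum w n.+1 m
| Subsum_add n m : subsum w n m -> subsum w n.+1 (vec_add m (w n)).

Lemma subsum_le w n k m : (n <= k)%N -> subsum w n m -> subsum w k m.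
Proof.
move=> /subnK <- h; elim: (k - n)%N => [//|i IH].
by rewrite addSn; apply: Subsum_skip.
Qed.

Section Recurrence.
Variable b : nat.
Hypothesis b_ge5 : (5 <= b)%N.
Variable D : nat -> set nat.
Hypothesis D_cover : forall n, (0 < n)%N -> exists l, D l n.
Hypothesis D_triv : trivIset [set: nat] D.
Hypothesis D_inf : forall l, infinite_set (D l).
Implicit Types (p : bool) (M N : set (nat -> nat)) (m : nat -> nat).

Local Notation kval := (kval b).
Local Notation r := (length_vector b D).
Local Notation length_vec := (length_vec D).
Local Notation labeled := (labeled b D).
Local Notation labeled_seq := (labeled_seq b D).

Lemma labeled_double p q M N t : labeled p M t -> labeled q N (t + t) -> t = 0.
Proof.
move=> /(labeledP b_ge5)[s [hs <- _]] /(labeledP b_ge5)[s' [hs' es' _]].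
exact: (double_balanced b_ge5 hs hs' es').
Qed.

(** The window of x[M] around [2 * b ^ K] is empty, as it falls in a gap of the
    balanced numbers. *)
Lemma zero_in_orbit_closure p M : orbit_closure shiftZ (labeled_seq p M) zero_seq.
Proof.
apply/orbit_closureP => L; have [B LB] := seq_bounded L.
pose K := (4 * B)%N; have hK : (K < b ^ K)%N by apply: ltn_expl; lia.
(* Within [B] of [2 b ^ K], four times the size lies between [5 b ^ K] and [15 b ^ K]. *)
exists (2 * (b ^ K)%N%:Z) => t /(allP LB) tB.
apply/negbTE/(labeled_seqP b D p M) => /(labeledP b_ge5)[s [hs es _]].
by have := kval_gap b_ge5 K hs; rewrite es; lia.
Qed.

(** Recurrence would write x[N] as a limit of its own shifts, hence as the
    point of a limit label of [N], along nonzero high [v]. The limit label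
    being [N] itself, [N] could have no maximal element. *)
Lemma labeled_seq_nonrecurrent p N : is_label N -> finite_type N -> N vec0 ->
  ~ recurrent shiftZ (labeled_seq p N).
Proof.
move=> hN fN N0 /recurrentP rec.
have [G [GU G0 Grec]] : exists G : set_system int, [/\ UltraFilter G, G [set n | n != 0] &
    forall t, G [set n | labeled_seq p N (t + n) = labeled_seq p N t]].
  by apply: ultra_of_finite => L; have [n n0 hn] := rec L; exists n.
have GN : G (labeled p N).
  apply: filterS (Grec 0) => n /=; rewrite add0r => e.
  by apply/(labeled_seqP b D p N); rewrite e labeled_seq_vec0.
have [u [N' [hu hN' N'N N'0 [N'G lim]]]] := shift_limit b_ge5 D_cover hN fN GU GN.
have eq t : labeled_seq p N t = labeled_seq p N' (t + kval u).
  by have [n [<- <-]] := filter_ex (filterI (Grec t) (lim t)).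
(* [u] and its double both belong to A[N'], as N' is inside [N]. *)
have u0 : kval u = 0.
  have N'u : labeled p N' (kval u).
    by apply/(labeled_seqP b D p N'); rewrite -[kval u]add0r -eq labeled_seq_vec0.
  apply: (labeled_double N'u); apply/(labeled_seqP b D p N'); rewrite -eq.
  by apply/(labeled_seqP b D p N)/(labeled_sub b_ge5 N'N).
have NN' : N `<=` N'.
  apply: (labeled_seq_sub_label b_ge5 D_triv D_inf (p := p) hN).
  by apply/funext => t; rewrite eq u0 addr0.
have [m Nm max] := finite_type_maximal fN N0.
have Gm := N'G m (NN' m Nm).
have [n [/= n0 [Nn]]] := filter_ex (filterI G0 (filterI GN Gm)).
rewrite /= u0 subr0 => Nmn.
apply: max Nmn _; split=> [l|e]; first exact: leq_addr.
move: Nn n0 => /(labeledP b_ge5)[s [hs es _]]; rewrite -es.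
have -> : s = [::]; last by rewrite kval_nil eqxx.
apply: (length_vec_eq0 D_cover hs); rewrite -(length_vector_kval b_ge5 D hs) es.
by apply/funext => l; have := congr1 (@^~ l) e; rewrite /vec_add /vec0; lia.
Qed.

Lemma finite_type_recurrent p M y : is_label M -> finite_type M ->
  orbit_closure shiftZ (labeled_seq p M) y -> recurrent shiftZ y -> y = zero_seq.
Proof.
move=> hM fM.
suff key z : orbit_closure shiftZ (labeled_seq p M) z -> recurrent shiftZ z -> z 0 = false.
  move=> Xy ry; apply/funext => t.
  have := key _ (@orbit_closure_shift _ _ t Xy) (@recurrent_shift _ t ry).
  by rewrite add0r.
move=> /orbit_closureP Xz rz; apply/negbTE/negP => z0.
have [G [GU _ Gz]] : exists G : set_system int, [/\ UltraFilter G, G setT &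
    forall t, G [set n | labeled_seq p M (t + n) = z t]].
  by apply: ultra_of_finite => L; have [n hn] := Xz L; exists n.
have GM : G (labeled p M).
  apply: filterS (Gz 0) => n /=; rewrite add0r => e.
  by apply/(labeled_seqP b D p M); rewrite e.
have [u [N [hu hN NM N0 [_ lim]]]] := shift_limit b_ge5 D_cover hM fM GU GM.
have zE t : z t = labeled_seq p N (t + kval u).
  by have [n [<- <-]] := filter_ex (filterI (Gz t) (lim t)).
apply: (@labeled_seq_nonrecurrent p N hN (finite_type_sub NM fM) N0).
have := @recurrent_shift _ (- kval u) rz.
by congr (recurrent _ _); apply/funext => t; rewrite zE subrK.
Qed.

(** Recurrence is obtained by minimality: a label that is minimal among those
    containing all [subsum w] and whose point lies in the orbit closure is its
    own limit label along the numbers that realise the [w i]. *)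
Lemma infinite_type_recurrent p M : is_label M -> ~ finite_type M ->
  exists x, [/\ orbit_closure shiftZ (labeled_seq p M) x, recurrent shiftZ x & ~ periodic shiftZ x].
Proof.
move=> hM /contrapT[c [Mc clt]].
pose w i l := (c i.+1 l - c i l)%N.
have w0 i : w i <> vec0.
  have [le ne] := clt i; move=> e; apply: ne; apply/funext => l.
  by have := congr1 (@^~ l) e; have := le l; rewrite /w /vec0; lia.
have Mw n m : subsum w n m -> M m.
  move=> sm; apply: label_le hM _ (Mc n); elim: sm => {n m} [l|n m _ IH l|n m _ IH l] //.
    exact: leq_trans (IH l) ((clt n).1 l).
  by have := IH l; have := (clt n).1 l; rewrite /vec_add /w; lia.
have /choice[s hs] : forall i, exists s,
    [/\ balanced true s, all (fun j => i < `|j|)%N s & length_vec s = w i].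
  move=> i; apply: (realize_vec D_triv D_inf i); apply: (@FIN_le _ (c i.+1)); last exact: hM.1.
  by move=> l; rewrite /w leq_subr.
have bs i : balanced p (s i) by have [h _ _] := hs i; apply: balanced_true.
have rs i : r (kval (s i)) = w i by have [_ _ <-] := hs i; exact: length_vector_kval (bs i).
have [G [GU _ Gs]] : exists G : set_system int, [/\ UltraFilter G, G setT &
    forall t : int, G [set n | exists2 i, (`|t| <= i)%N & n = kval (s i)]].
  apply: ultra_of_finite => L; have [B LB] := seq_bounded L.
  by exists (kval (s B)) => // t /(allP LB) tB; exists B.
have Gh K : G (high_set b p K).
  apply: filterS (Gs (Posz K)) => n [i Ki ->]; exists (s i); split=> //.
  by have [_ si _] := hs i; apply: sub_all si => j /= h; apply: leq_ltn_trans Ki h.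
pose fam N := [/\ is_label N, forall n m, subsum w n m -> N m &
  orbit_closure shiftZ (labeled_seq p M) (labeled_seq p N)].
have famM : fam M by split=> //; exact: orbit_closure_self.
(* A finite sum of the [w i] can still be enlarged by almost every [w i]. *)
have fam_lim N : fam N -> fam (limit_label b D G N).
  move=> [hN Nw XN]; split; first exact: limit_is_label.
    move=> n m sm; apply: filterS (Gs (Posz n)) => _ [i ni ->] /=; rewrite rs.
    by apply: (Nw i.+1); apply: Subsum_add; apply: subsum_le sm.
  apply/orbit_closureP => L.
  have [n hn] := filter_ex (filter_all_seq (L := L) _ (fun t _ => labeled_seq_limit b_ge5 D t GU Gh hN)).
  have [n' hn'] := (orbit_closureP _ _).1 XN [seq t + n | t <- L].
  exists (n + n') => t tL; rewrite -hn // addrA; apply: hn'; exact: map_f.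
have [N [famN minN]] : exists N, fam N /\ forall N', fam N' -> N' `<=` N -> N' = N.
  (* The order is reversed inclusion, so that a maximal element is a minimal label. *)
  pose T := {N | fam N}; pose R (S1 S2 : T) := `[< sval S2 `<=` sval S1 >].
  have [||||[N famN] max] := @Zorn T R.
  - by move=> S; apply/asboolP.
  - by move=> S1 S2 S3 /asboolP h1 /asboolP h2; apply/asboolP; apply: subset_trans h1.
  - move=> [N1 f1] [N2 f2] /asboolP h1 /asboolP h2; apply: eq_exist.
    by rewrite eqEsubset.
  - move=> A tot; have [[S0 AS0]|A0] := pselect (A !=set0); last first.
      by exists (exist _ M famM) => S AS; case: A0; exists S.
    pose I := [set m | forall S, A S -> sval S m].
    have II : is_label I.
      split=> [m /(_ _ AS0)|m1 m Fm1 le Im S AS]; first by have [[NF _] _ _] := svalP S0; apply: NF.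
      have [hS _ _] := svalP S; exact: label_le hS le (Im S AS).
    suff famI : fam I by exists (exist _ I famI) => S AS; apply/asboolP => m /(_ _ AS).
    split=> //; first by move=> n m sm S _; have [_ Sw _] := svalP S; apply: Sw sm.
    apply/orbit_closureP => L.
    (* A chain of labels decreases to its intersection, and on a finite window the limit is reached by some member of the chain. *)
    have [S AS LS] : exists2 S, A S & forall t, t \in L -> labeled_seq p (sval S) t -> labeled_seq p I t.
      elim: L => [|t L [S AS LS]]; first by exists S0.
      have [S' AS' tS'] : exists2 S', A S' & labeled_seq p (sval S') t -> labeled_seq p I t.
        have [It|It] := boolP (labeled_seq p I t); first by exists S.
        have [[S' AS' nS']|all] := pselect (exists2 S', A S' & ~ labeled p (sval S') t).
          by exists S' => // /(labeled_seqP b D p _).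
        have hall S' : A S' -> labeled p (sval S') t.
          by move=> AS'; apply: contrapT => h; apply: all; exists S'.
        exists S => // _; case/negP: It; apply/(labeled_seqP b D p _).
        have /(labeledP b_ge5)[s' [bs' es' _]] := hall _ AS.
        apply/(labeledP b_ge5); exists s'; split=> // S' AS'.
        by apply/(labeled_kval b_ge5 D _ bs'); rewrite es'; apply: hall.
      have mono (S1 S2 : T) t' : sval S1 `<=` sval S2 -> labeled_seq p (sval S1) t' -> labeled_seq p (sval S2) t'.
        by move=> le /(labeled_seqP b D p _) h; apply/(labeled_seqP b D p _); exact: (labeled_sub b_ge5 le h).
      have [/asboolP le|/asboolP le] := tot S S' AS AS'.
        exists S' => // t'; rewrite inE => /orP[/eqP -> //|t'L /(mono _ _ _ le)].
        exact: LS.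
      exists S => // t'; rewrite inE => /orP[/eqP -> /(mono _ _ _ le) //|t'L].
      exact: LS.
    have [_ _ XS] := svalP S; have [n hn] := (orbit_closureP _ _).1 XS L.
    exists n => t tL; rewrite hn //; apply/idP/idP; first exact: LS.
    move=> /(labeled_seqP b D p _) h; apply/(labeled_seqP b D p _); apply: (labeled_sub b_ge5 _ h).
    by move=> m /(_ _ AS).
  exists N; split=> // N' famN' le.
  by have /(congr1 sval) := max (exist _ N' famN') (asboolT le).
have [hN Nw XN] := famN.
have NE : limit_label b D G N = N by apply: minN; [exact: fam_lim|exact: limit_label_sub].
exists (labeled_seq p N); split=> //.
  apply/recurrentP => L.
  have [n [hn [i _ en]]] := filter_ex (filterI
    (filter_all_seq (L := L) _ (fun t _ => labeled_seq_limit b_ge5 D t GU Gh hN)) (Gs 0)).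
  rewrite NE in hn; exists n => //; apply/eqP => n0; apply: (w0 i).
  rewrite n0 in en; have := kval_eq0 b_ge5 (bs i) (esym en).
  by have [_ _ <-] := hs i => ->.
move=> [n n0]; rewrite iterz_shiftZ => per.
have N0 : N vec0 by apply: (Nw 0%N); apply: Subsum0.
have xn : labeled_seq p N n.
  by have := congr1 (@^~ 0) per; rewrite /= add0r => ->; rewrite labeled_seq_vec0.
have xnn : labeled_seq p N (n + n) by have := congr1 (@^~ n) per; rewrite /= => ->.
move/negP: n0; apply; apply/eqP.
by apply: (@labeled_double p p N N); apply/(labeled_seqP b D p N).
Qed.

End Recurrence.

Theorem corollary3p36 (R : realType) (b : nat) (D : nat -> set nat)
    (b_odd : odd b) (b_ge5 : (5 <= b)%N) (hD : admissible_partition D)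
    (M : set (nat -> nat)) (hM : is_label M) :
  (~ finite_type M ->
     (exists x : seqZ, [/\ X_ b D M x, recurrent shiftZ x & ~ periodic shiftZ x]) /\
     (exists x : seqZ, [/\ Xp_ b D M x, recurrent shiftZ x & ~ periodic shiftZ x]))
  /\
  (finite_type M ->
     [/\ X_ b D M `&` [set x | recurrent shiftZ x] = [set zero_seq],
         Xp_ b D M `&` [set x | recurrent shiftZ x] = [set zero_seq],
         center_trivial shiftZ (X_ b D M) &
         center_trivial shiftZ (Xp_ b D M)] /\
     [/\ forall d : seqZ -> seqZ -> R, compatible_metric d ->
           locally_equicontinuous d shiftZ (X_ b D M) /\
           locally_equicontinuous d shiftZ (Xp_ b D M),
         topologically_transitive shiftZ (X_ b D M),
         topologically_transitive shiftZ (Xp_ b D M) &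
         (* for M = set0 both systems are the fixed point zero_seq, which is
            trivially weak mixing *)
         M !=set0 ->
           ~ weak_mixing shiftZ (X_ b D M) /\ ~ weak_mixing shiftZ (Xp_ b D M)]).
Proof.
have [[Dcov Dtriv _] Dinf _] := hD.
have D_cover n : (0 < n)%N -> exists l, D l n.
  by move=> n0; have : [set n | (0 < n)%N] n by []; rewrite -Dcov => -[l _ Dl]; exists l.
have X_E : X_ b D M = orbit_closure shiftZ (labeled_seq b D false M) by [].
have Xp_E : Xp_ b D M = orbit_closure shiftZ (labeled_seq b D true M) by [].
split=> [nM|fM].
  by rewrite X_E Xp_E; split; apply: infinite_type_recurrent.
have rec p y : orbit_closure shiftZ (labeled_seq b D p M) y -> recurrent shiftZ y -> y = zero_seq.
  exact: finite_type_recurrent.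
have only p : orbit_closure shiftZ (labeled_seq b D p M) `&` [set x | recurrent shiftZ x] = [set zero_seq].
  rewrite eqEsubset; split=> [y [] /=|_ ->]; first exact: rec.
  by split; [exact: zero_in_orbit_closure|exact: recurrent_zero].
have ct p : center_trivial shiftZ (orbit_closure shiftZ (labeled_seq b D p M)).
  exists zero_seq; split=> [|y [Xy ry]]; last by rewrite (rec p y Xy ry).
  by split; [exact: zero_in_orbit_closure|exact: recurrent_zero].
have nwm p m : M m -> ~ weak_mixing shiftZ (orbit_closure shiftZ (labeled_seq b D p M)).
  move=> /(label_vec0 hM) M0; apply: nonrecurrent_not_mixing => /rec.
  move=> /(_ p (@orbit_closure_self _)) e.
  by have := labeled_seq_vec0 b_ge5 D p M0; rewrite e.
rewrite X_E Xp_E; split; first by split.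
split; [|exact: transitive_orbit_closure..|].
  by move=> d hd; split; apply: compatible_equicontinuous => // x; apply: rec.
by move=> [m Mm]; split; apply: nwm Mm.
Qed.
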